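(* Let $M$ be a term of the $\partial_0\lambda$-calculus (without tests) and $\vec x$ a repetition-free list of variables containing its free variables. The following are equivalent: (i) $M$ is solvable; (ii) $M\twoheadrightarrow N+\mathbb N$ for some term $N$ in normal form and some finite sum of terms $\mathbb N$; (iii) $\llbracket M\rrbracket_{\vec x}\neq\emptyset$.
   Context: The $\partial_0\lambda$-calculus (without tests). Terms $M::=x\mid\lambda x.M\mid MP$, bags $P::=[L_1,\dots,L_k]$ ($k\ge0$, a finite multiset of terms), up to $\alpha$-equivalence. Sums of terms are finite formal sums with idempotent addition, $0$ the empty sum; constructors are extended to sums multilinearly (e.g. $\lambda x.\sum_iM_i=\sum_i\lambda x.M_i$, $(\sum_iM_i)(\sum_jP_j)=\sum_{i,j}M_iP_j$, $[\sum_iL_i]\uplus P=\sum_i[L_i]\uplus P$), so constructors applied to $0$ give $0$. $A\{0/x\}$ equals $0$ if $x$ is free in $A$ and $A$ otherwise. Linear substitution: $x\langle N/x\rangle=N$, $y\langle N/x\rangle=0$ ($y\ne x$), $(\lambda y.M)\langle N/x\rangle=\lambda y.M\langle N/x\rangle$, $(MP)\langle N/x\rangle=M\langle N/x\rangle P+M(P\langle N/x\rangle)$, $[L_1,\dots,L_k]\langle N/x\rangle=\sum_i[L_1,\dots,L_i\langle N/x\rangle,\dots,L_k]$; for $P=[L_1,\dots,L_k]$ with $x$ not free in $P$, $A\langle P/x\rangle:=A\langle L_1/x\rangle\cdots\langle L_k/x\rangle$. The only reduction rule is $(\lambda x.M)P\to M\langle P/x\rangle\{0/x\}$, closed under all syntactic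 positions and under sums; $\twoheadrightarrow$ is the reflexive-transitive closure. A term is in normal form if no reduction applies to it. Term-contexts: $D::=[\cdot]\mid\lambda x.D\mid DP\mid M[D,L_1,\dots,L_k]$; $D[M]$ replaces the hole by $M$ allowing capture. With $\mathbf I:=\lambda x.x$, $M$ is solvable if there is a term-context $D$ with $D[M]\twoheadrightarrow\mathbf I$. The model $\mathcal D$. $\mathcal M_f(S)$ = finite multisets over $S$. $D_0=\emptyset$, $D_{n+1}$ = $\mathbb N$-indexed sequences $(a_1,a_2,\dots)$ of elements of $\mathcal M_f(D_n)$ with all but finitely many empty; $\mathcal D=\bigcup_nD_n$; $a::(a_1,a_2,\dots):=(a,a_1,a_2,\dots)$; $\uplus$ on tuples is componentwise. For a repetition-free list $\vec x=x_1,\dots,x_n$ containing the free variables: $\llbracket x_i\rrbracket_{\vec x}=\{(([\,],\dots,[\alpha],\dots,[\,]),\alpha):\alpha\in\mathcal D\}$ ($[\alpha]$ in position $i$); $\llbracket\lambda y.M\rrbracket_{\vec x}=\{(\vec a,b::\alpha):((\vec a,b),\alpha)\in\llbracket M\rrbracket_{\vec x,y}\}$; $\llbracket MP\rrbracket_{\vec x}=\{(\vec a_1\uplus\vec a_2,\alpha):\exists b\,(\vec a_1,b::\alpha)\in\llbracket M\rrbracket_{\vec x},(\vec a_2,b)\in\llbracket P\rrbracket_{\vec x}\}$; $\llbracket[L_1,\dots,L_k]\rrbracket_{\vec x}=\{(\biguplus_i\vec a_i,[\beta_1,\dots,\beta_k]):(\vec a_i,\beta_i)\in\llbracket L_i\rrbracket_{\vec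 x}\}$; sums are interpreted as unions. *)

(* Defs.v *)
From HB Require Import structures.
From mathcomp Require Import all_boot.
From mathcomp Require Import finmap multiset.

Set Implicit Arguments.
Unset Strict Implicit.
Unset Printing Implicit Defensive.

Local Open Scope mset_scope.
Local Open Scope nat_scope.

(** * Syntax *)

(* De Bruijn indices represent terms up to alpha-equivalence: the variables
   are the naturals, an index that points beyond the enclosing [Lam]s denotes
   a free variable, and abstraction over a named variable is [abs] below.
   A bag is written as a list and read up to permutation at every depth,
   see [teq]. *)
Inductive term : Type :=
  | Var of nat
  | Lam of term
  | App of term & seq term.

Notation bag := (seq term).

(* A finite sum is the list of its summands; [sum_eq] makes addition
   associative, commutative and idempotent. The sum 0 is [[::]]. *)
Notation tsum := (seq term).

Lemma term_nested_ind (P : term -> Prop) :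
  (forall n, P (Var n)) ->
  (forall M, P M -> P (Lam M)) ->
  (forall M Q, P M -> foldr (fun L => and (P L)) True Q -> P (App M Q)) ->
  forall M, P M.
Proof.
move=> Pv Pl Pa; fix IH 1 => -[n | M | M Q]; [exact: Pv | exact: Pl |].
by apply: Pa => //; elim: Q => //= L Q IHQ; split.
Qed.

Fixpoint term_encode (M : term) : GenTree.tree nat :=
  match M with
  | Var n => GenTree.Leaf n
  | Lam M => GenTree.Node 0 [:: term_encode M]
  | App M P => GenTree.Node 1 (term_encode M :: map term_encode P)
  end.

Fixpoint term_decode (t : GenTree.tree nat) : term :=
  match t with
  | GenTree.Leaf n => Var n
  | GenTree.Node 0 (u :: _) => Lam (term_decode u)
  | GenTree.Node _ (u :: s) => App (term_decode u) (map term_decode s)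
  | GenTree.Node _ [::] => Var 0
  end.

Lemma term_encodeK : cancel term_encode term_decode.
Proof.
elim/term_nested_ind => //= [M -> // | M P -> IHP]; congr App.
by elim: P IHP => //= L P IH [-> /IH ->].
Qed.

HB.instance Definition _ := Countable.copy term (can_type term_encodeK).

(* Equality of terms: the congruence generated by permuting bags. *)
Inductive teq : term -> term -> Prop :=
  | teq_refl M : teq M M
  | teq_trans M1 M2 M3 : teq M1 M2 -> teq M2 M3 -> teq M1 M3
  | teq_perm M P Q : perm_eq P Q -> teq (App M P) (App M Q)
  | teq_lam M M' : teq M M' -> teq (Lam M) (Lam M')
  | teq_appl M M' P : teq M M' -> teq (App M P) (App M' P)
  | teq_appr M P L L' Q :
      teq L L' -> teq (App M (P ++ L :: Q)) (App M (P ++ L' :: Q)).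

Lemma teq_sym M M' : teq M M' -> teq M' M.
Proof.
elim=> {M M'}.
- exact: teq_refl.
- by move=> M1 M2 M3 _ h12 _ h23; apply: teq_trans h23 h12.
- by move=> M P Q hPQ; apply: teq_perm; rewrite perm_sym.
- by move=> M M' _; apply: teq_lam.
- by move=> M M' P _; apply: teq_appl.
- by move=> M P L L' Q _; apply: teq_appr.
Qed.

Definition sum_eq (S T : tsum) : Prop :=
  (forall M, M \in S -> exists2 N, N \in T & teq M N) /\
  (forall N, N \in T -> exists2 M, M \in S & teq M N).

Fixpoint free (x : nat) (M : term) : bool :=
  match M with
  | Var y => y == x
  | Lam M => free x.+1 M
  | App M P => free x M || has (free x) P
  end.

Definition up (f : nat -> nat) (n : nat) : nat :=
  if n is m.+1 then (f m).+1 else 0.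

Fixpoint ren (f : nat -> nat) (M : term) : term :=
  match M with
  | Var n => Var (f n)
  | Lam M => Lam (ren (up f) M)
  | App M P => App (ren f M) (map (ren f) P)
  end.

(* The term "lambda x. M" for the free variable [x] of [M]; all other free
   variables keep their names, hence get shifted under the binder. *)
Definition abs (x : nat) (M : term) : term :=
  Lam (ren (fun y => if y == x then 0 else y.+1) M).

Definition Iterm : term := Lam (Var 0).

(** * Reduction *)

(* The bags obtained by applying the sum-valued map [f] to exactly one
   element of a bag. *)
Fixpoint bag_apply1 (f : term -> tsum) (P : bag) : seq bag :=
  if P is L :: P' then
    [seq L' :: P' | L' <- f L] ++ [seq L :: Q | Q <- bag_apply1 f P']
  else [::].

Fixpoint lsubst (x : nat) (N : term) (M : term) : tsum :=
  match M with
  | Var y => if y == x then [:: N] else [::]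
  | Lam M => map Lam (lsubst x.+1 (ren succn N) M)
  | App M P =>
      [seq App M' P | M' <- lsubst x N M] ++
      [seq App M P' | P' <- bag_apply1 (lsubst x N) P]
  end.

Definition lsubst_sum (x : nat) (S : tsum) (N : term) : tsum :=
  flatten [seq lsubst x N M | M <- S].

Definition lsubst_bag (x : nat) (M : term) (P : bag) : tsum :=
  foldl (lsubst_sum x) [:: M] P.

Definition subst0 (x : nat) (S : tsum) : tsum := [seq M <- S | ~~ free x M].

(* The contractum of "(lambda x. M) P", the bound variable being index 0 of
   [M]: [P] is first moved under the binder (so that x is not free in it), and
   the binder is removed once x no longer occurs. *)
Definition beta (M : term) (P : bag) : tsum :=
  map (ren predn) (subst0 0 (lsubst_bag 0 M (map (ren succn) P))).

Inductive red : term -> tsum -> Prop :=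
  | red_beta M P : red (App (Lam M) P) (beta M P)
  | red_lam M S : red M S -> red (Lam M) (map Lam S)
  | red_appl M P S : red M S -> red (App M P) [seq App M' P | M' <- S]
  | red_appr M P L Q S : red L S ->
      red (App M (P ++ L :: Q)) [seq App M (P ++ L' :: Q) | L' <- S].

Definition sum_red (S T : tsum) : Prop :=
  exists M S' U, [/\ sum_eq S (M :: U), red M S' & sum_eq T (S' ++ U)].

Inductive sum_reds : tsum -> tsum -> Prop :=
  | sum_reds_refl S T : sum_eq S T -> sum_reds S T
  | sum_reds_step S T U : sum_red S T -> sum_reds T U -> sum_reds S U.

Definition normal (M : term) : Prop := ~ exists S, red M S.

Definition has_normal_summand (M : term) : Prop :=
  exists (N : term) (S : tsum), normal N /\ sum_reds [:: M] (N :: S).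

(** * Term-contexts and solvability *)

(* [CLam x D] binds the free variable [x] of the term plugged into [D]. *)
Inductive ctx : Type :=
  | CHole
  | CLam of nat & ctx
  | CAppl of ctx & bag
  | CAppr of term & ctx & bag.

Fixpoint plug (D : ctx) (M : term) : term :=
  match D with
  | CHole => M
  | CLam x D => abs x (plug D M)
  | CAppl D P => App (plug D M) P
  | CAppr N D P => App N (plug D M :: P)
  end.

Definition solvable (M : term) : Prop :=
  exists D : ctx, sum_reds [:: plug D M] [:: Iterm].

(** * The domain of the model *)

(* Every element of the domain is built from the sequence of empty multisets
   by finitely many uses of "::"; multisets are represented by lists sorted
   along an arbitrary enumeration, and the domain consists of the canonical
   representatives, those fixed by [rnorm]. *)
Inductive rawdom : Type :=
  | RStar
  | RCons of seq rawdom & rawdom.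

Lemma rawdom_nested_ind (P : rawdom -> Prop) :
  P RStar ->
  (forall s r, foldr (fun t => and (P t)) True s -> P r -> P (RCons s r)) ->
  forall r, P r.
Proof.
move=> Ps Pc; fix IH 1 => -[// | s r]; apply: Pc => //.
by elim: s => //= t s IHs; split.
Qed.

Fixpoint rawdom_encode (r : rawdom) : GenTree.tree unit :=
  if r is RCons s r' then
    GenTree.Node 0 (rawdom_encode r' :: map rawdom_encode s)
  else GenTree.Leaf tt.

Fixpoint rawdom_decode (t : GenTree.tree unit) : rawdom :=
  if t is GenTree.Node _ (u :: s) then
    RCons (map rawdom_decode s) (rawdom_decode u)
  else RStar.

Lemma rawdom_encodeK : cancel rawdom_encode rawdom_decode.
Proof.
elim/rawdom_nested_ind => //= s r IHs ->; congr RCons.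
by elim: s IHs => //= t s IH [-> /IH ->].
Qed.

HB.instance Definition _ := Countable.copy rawdom (can_type rawdom_encodeK).

Definition rle : rel rawdom := relpre choice.pickle leq.

Lemma rle_total : total rle.
Proof. by move=> r t; apply: leq_total. Qed.

Lemma rle_trans : transitive rle.
Proof. by move=> r t u; apply: leq_trans. Qed.

Lemma rle_anti : antisymmetric rle.
Proof. by move=> r t /anti_leq; apply: (pcan_inj choice.pickleK). Qed.

Definition rcons_norm (s : seq rawdom) (r : rawdom) : rawdom :=
  if (s, r) is ([::], RStar) then RStar else RCons s r.

Fixpoint rnorm (r : rawdom) : rawdom :=
  if r is RCons s r' then rcons_norm (sort rle (map rnorm s)) (rnorm r')
  else RStar.

Record dom : Type := Dom { dval : rawdom; dvalP : rnorm dval == dval }.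

HB.instance Definition _ := [isSub for dval].
HB.instance Definition _ := [Countable of dom by <:].

Lemma rnorm_cons s r : all (fun t => rnorm t == t) s -> rnorm r == r ->
  rnorm (rcons_norm (sort rle s) r) == rcons_norm (sort rle s) r.
Proof.
move=> hs hr; have Es : map rnorm (sort rle s) = sort rle s.
  have /allP {}hs: all (fun t => rnorm t == t) (sort rle s) by rewrite all_sort.
  by apply: map_id_in => t /hs /eqP.
have Ess : sort rle (sort rle s) = sort rle s.
  by apply/sorted_sort; [apply: rle_trans | apply/sort_sorted/rle_total].
have E : rnorm (RCons (sort rle s) r) = rcons_norm (sort rle s) r.
  by rewrite /= Es Ess (eqP hr).
rewrite {1}/rcons_norm; case: (sort rle s) E => [|t u] E; last by rewrite E.
by case: r hr E => [|t u] hr E; rewrite ?E.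
Qed.

Definition dstar : dom := @Dom RStar (eqxx _).

Lemma dcons_subproof (a : {mset dom}) (alpha : dom) :
  let r := rcons_norm (sort rle (map dval a)) (dval alpha) in rnorm r == r.
Proof.
by apply: rnorm_cons (dvalP _); apply/allP => _ /mapP[t _ ->]; apply: dvalP.
Qed.

Definition dcons (a : {mset dom}) (alpha : dom) : dom :=
  Dom (dcons_subproof a alpha).

Lemma dcons0 : dcons mset0 dstar = dstar.
Proof. by apply: val_inj; rewrite /= enum_mset0. Qed.

Lemma dcons_inj a b alpha beta :
  dcons a alpha = dcons b beta -> a = b /\ alpha = beta.
Proof.
move=> /(congr1 dval) /= E.
have {E}[Es Er] : sort rle (map dval a) = sort rle (map dval b) /\
    dval alpha = dval beta.
  move: E; rewrite /rcons_norm; move: (sort _ _) (sort _ _) => s t.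
  by case: s t (dval alpha) (dval beta) => [|? ?] [|? ?] [|? ?] [|? ?] //= E;
    split; congruence.
split; last exact: val_inj.
have /(perm_map_inj val_inj)/eq_seq_msetP :
    perm_eq (map dval a) (map dval b).
  by apply/(perm_sortP rle_total rle_trans rle_anti).
by rewrite !seq_mset_id.
Qed.

Lemma rnorm_idem r : rnorm (rnorm r) = rnorm r.
Proof.
elim/rawdom_nested_ind: r => //= s r IHs IHr; apply/eqP/rnorm_cons; last first.
  exact/eqP.
by elim: s IHs => //= t s IH [/eqP -> /IH ->].
Qed.

Lemma dom_ind (P : dom -> Prop) :
  P dstar ->
  (forall a alpha, (forall beta, beta \in a -> P beta) -> P alpha ->
     P (dcons a alpha)) ->
  forall alpha, P alpha.
Proof.
move=> Ps Pc [r hr].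
suff H : forall h : rnorm r == r, P (Dom h) by apply: H.
elim/rawdom_nested_ind: r {hr} => [|s r IHs IHr] h.
  by rewrite (_ : Dom h = dstar) //; apply: val_inj.
have /= := eqP h; rewrite /rcons_norm => E.
have {E} [Es Er] : sort rle (map rnorm s) = s /\ rnorm r = r.
  by move: E; case: (sort _ _) (rnorm r) => [|? ?] [|? ?] // [<- <-].
have ns : all (fun t => rnorm t == t) s.
  by rewrite -Es all_sort; apply/allP => _ /mapP[t _ ->]; rewrite rnorm_idem.
have Esort : sort rle s = s.
  by apply/sorted_sort; [apply: rle_trans | rewrite -Es; apply/sort_sorted/rle_total].
pose s' : seq dom := pmap insub s.
have Es' : map dval s' = s.
  rewrite /s'; elim: (s) ns => //= t u IH /andP[ht /IH E].
  by rewrite insubT /= E.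
have Ps' beta : beta \in s' -> P beta.
  have : foldr (fun t => and (forall h, P (@Dom t h))) True (map dval s').
    by rewrite Es'.
  elim: (s') => //= t u IH [ht /IH {}IH]; rewrite inE => /predU1P[->|/IH //].
  by case: t ht.
rewrite (_ : Dom h = dcons (seq_mset s') (Dom (introT eqP Er))).
  apply: Pc => [beta|]; last exact: IHr.
  by rewrite (perm_mem (perm_eq_seq_mset s')); apply: Ps'.
apply: val_inj => /=.
have /(perm_sortP rle_total rle_trans rle_anti) -> :
    perm_eq (map dval (seq_mset s')) (map dval s').
  exact/perm_map/perm_eq_seq_mset.
by rewrite Es' Esort -[LHS](eqP h) /= Es Er.
Qed.

(* The elements of the domain are the sequences of multisets with finitely
   many nonempty components: [dcomp alpha n] is the component number [n],
   [dom_ext] and [dom_surj] are extensionality and comprehension, and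
   [dom_ind] says that the domain is the least such set. *)
Fixpoint rcomp (r : rawdom) (n : nat) : seq rawdom :=
  match r, n with
  | RStar, _ => [::]
  | RCons s _, 0 => s
  | RCons _ r', m.+1 => rcomp r' m
  end.

Definition dcomp (alpha : dom) (n : nat) : {mset dom} :=
  seq_mset (pmap insub (rcomp (dval alpha) n)).

Lemma dcomp_star n : dcomp dstar n = mset0.
Proof. by apply/msetP => x; rewrite mset_seqE mset0E. Qed.

Lemma dcomp_cons a alpha n :
  dcomp (dcons a alpha) n = if n is m.+1 then dcomp alpha m else a.
Proof.
have Ea : seq_mset (pmap insub (sort rle (map dval a)) : seq dom) = a.
  rewrite -[RHS]seq_mset_id; apply/eq_seq_msetP.
  rewrite (perm_trans (perm_pmap _ (permEl (perm_sort rle _)))) //.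
  rewrite (_ : pmap insub _ = a :> seq dom) //.
  by elim: (a : seq dom) => //= t s ->; rewrite valK.
rewrite /dcomp /= /rcons_norm; move: Ea.
by case: (sort rle _) (dval alpha) => [|t s] [|u r] /= Ea; case: n => [|[|n]].
Qed.

Lemma dom_ext alpha beta : dcomp alpha =1 dcomp beta -> alpha = beta.
Proof.
elim/dom_ind: alpha beta => [|a alpha _ IH] beta.
  elim/dom_ind: beta => // b beta _ IH E.
  have := E 0; rewrite dcomp_cons dcomp_star => <-.
  rewrite -IH ?dcons0 // => n.
  by have := E n.+1; rewrite dcomp_cons !dcomp_star.
elim/dom_ind: beta => [|b beta _ _] E.
  have := E 0; rewrite dcomp_cons dcomp_star => ->.
  rewrite (IH dstar) ?dcons0 // => n.
  by have := E n.+1; rewrite dcomp_cons !dcomp_star.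
have := E 0; rewrite !dcomp_cons => ->; congr dcons; apply: IH => n.
by have := E n.+1; rewrite !dcomp_cons.
Qed.

Lemma dom_surj (f : nat -> {mset dom}) (k : nat) :
  (forall n, k <= n -> f n = mset0) -> exists alpha, dcomp alpha =1 f.
Proof.
elim: k f => [|k IH] f fk.
  by exists dstar => n; rewrite dcomp_star fk.
have [n kn|alpha Ea] := IH (fun n => f n.+1); first exact: fk.
by exists (dcons (f 0) alpha) => -[|n]; rewrite dcomp_cons.
Qed.

(** * Interpretation *)

Definition tuple_add (a1 a2 : seq {mset dom}) : seq {mset dom} :=
  [seq p.1 `+` p.2 | p <- zip a1 a2].

(* The tuple ([], ..., [alpha], ..., []) over the repetition-free list [xs],
   with [alpha] at the position of [y]. *)
Definition tuple_unit (xs : seq nat) (y : nat) (alpha : dom) :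
    seq {mset dom} :=
  [seq if x == y then [mset alpha] else mset0 | x <- xs].

(* [I a beta] is the interpretation of a term, over a list of [n] variables. *)
Fixpoint bag_interp (n : nat) (I : term -> seq {mset dom} -> dom -> Prop)
    (P : bag) (a : seq {mset dom}) (b : {mset dom}) : Prop :=
  if P is L :: P' then
    exists a1 a2 beta b',
      [/\ a = tuple_add a1 a2, b = beta +` b',
          I L a1 beta & bag_interp n I P' a2 b']
  else a = nseq n mset0 /\ b = mset0.

(* [interp xs M a alpha] : the pair [(a, alpha)] belongs to the interpretation
   of [M] with respect to [xs]. Under a binder, the variables of [xs] are
   shifted and the bound variable is the index 0. *)
Fixpoint interp (xs : seq nat) (M : term) (a : seq {mset dom}) (alpha : dom)
    : Prop :=
  match M with
  | Var y => y \in xs /\ a = tuple_unit xs y alpha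
  | Lam M =>
      exists b beta,
        alpha = dcons b beta /\
        interp (rcons (map succn xs) 0) M (rcons a b) beta
  | App M P =>
      exists a1 a2 b,
        [/\ a = tuple_add a1 a2, interp xs M a1 (dcons b alpha) &
            bag_interp (size xs) (interp xs) P a2 b]
  end.

(* Main.v *)
(* Resource terms are linear, so the interpretation is invariant under reduction
   in both directions. Every step removes exactly one application, hence each
   term reduces to a sum of normal forms, and a nonempty interpretation forces
   this sum to be nonzero. Conversely, a normal form can be typed so that all
   its argument types are inhabited by closed terms: give each head variable a
   closed term that tests the elements of its bags one after the other against
   the identity. A context passing these closed terms to M yields a closed term
   G that has every type [delta]::delta. Finally, every closed term applied to
   sufficiently many singleton bags [I] reduces to I or to 0, and the types of G
   exclude 0. *)
Require Import Defs.
From mathcomp Require Import all_boot.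
From mathcomp Require Import finmap multiset.
From Stdlib Require Import Classical FunctionalExtensionality.

Set Implicit Arguments.
Unset Strict Implicit.
Unset Printing Implicit Defensive.

Local Open Scope mset_scope.
Local Open Scope nat_scope.

(** * Induction through bags and arithmetic of multisets *)

Lemma term_ind_mem (P : term -> Prop) :
  (forall n, P (Var n)) ->
  (forall M, P M -> P (Lam M)) ->
  (forall M Q, P M -> (forall L, L \in Q -> P L) -> P (App M Q)) ->
  forall M, P M.
Proof.
move=> Pv Pl Pa; elim/term_nested_ind => // M Q PM PQ; apply: Pa => //.
elim: Q PQ => // L Q IH [PL /IH PQ] K; rewrite inE => /predU1P[->|/PQ] //.
Qed.

Lemma msetD_eq0 (a b : {mset dom}) :
  (a `+` b == mset0) = (a == mset0) && (b == mset0).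
Proof.
apply/eqP/andP => [/msetP E|[/eqP -> /eqP ->]]; last by rewrite msetD0.
by split; apply/eqP/msetP => x; have:= E x;
  rewrite msetE2 mset0E => /eqP; rewrite addn_eq0 => /andP[/eqP ? /eqP ?].
Qed.

Lemma msetDI (a b c : {mset dom}) : a `+` b = a `+` c -> b = c.
Proof. by move=> E; rewrite -[b](msetDKB a) E msetDKB. Qed.

(** * Environments *)

(** Environments cover all indices at once, so splitting them needs no list of variables; tuples
    over [xs] are recovered later by [map e xs]. *)
Definition env := nat -> {mset dom}.

Definition env0 : env := fun=> mset0.

Definition eadd (e1 e2 : env) : env := fun n => e1 n `+` e2 n.

Definition ebag (x : nat) (b : {mset dom}) : env :=
  fun n => if n == x then b else mset0.

Definition econs (b : {mset dom}) (e : env) : env :=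
  fun n => if n is m.+1 then e m else b.

Lemma eaddC e1 e2 : eadd e1 e2 = eadd e2 e1.
Proof. by apply: functional_extensionality => n; apply: msetDC. Qed.

Lemma eaddA e1 e2 e3 : eadd e1 (eadd e2 e3) = eadd (eadd e1 e2) e3.
Proof. by apply: functional_extensionality => n; apply: msetDA. Qed.

Lemma eadd0 e : eadd e env0 = e.
Proof. by apply: functional_extensionality => n; apply: msetD0. Qed.

Lemma eadd0e e : eadd env0 e = e.
Proof. by rewrite eaddC eadd0. Qed.

Lemma eaddCA e1 e2 e3 : eadd e1 (eadd e2 e3) = eadd e2 (eadd e1 e3).
Proof. by rewrite !eaddA (eaddC e1). Qed.

Lemma eaddAC e1 e2 e3 : eadd (eadd e1 e2) e3 = eadd (eadd e1 e3) e2.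
Proof. by rewrite -!eaddA (eaddC e2). Qed.

Lemma eaddI e e1 e2 : eadd e e1 = eadd e e2 -> e1 = e2.
Proof.
move=> E; apply: functional_extensionality => n.
exact: msetDI (congr1 (@^~ n) E).
Qed.

Lemma ebag0 x : ebag x mset0 = env0.
Proof. by apply: functional_extensionality => n; rewrite /ebag if_same. Qed.

Lemma ebagD x a b : ebag x (a `+` b) = eadd (ebag x a) (ebag x b).
Proof.
apply: functional_extensionality => n; rewrite /ebag /eadd.
by case: eqP; rewrite ?msetD0.
Qed.

Lemma econsD a b e1 e2 :
  econs (a `+` b) (eadd e1 e2) = eadd (econs a e1) (econs b e2).
Proof. by apply: functional_extensionality => -[]. Qed.

Lemma econs_eta e : e = econs (e 0) (fun n => e n.+1).
Proof. by apply: functional_extensionality => -[]. Qed.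

Lemma econs0 : econs mset0 env0 = env0.
Proof. by apply: functional_extensionality => -[]. Qed.

Lemma econs_bag0 b e : econs b e = eadd (ebag 0 b) (econs mset0 e).
Proof.
by apply: functional_extensionality => -[|n]; rewrite /eadd /= ?msetD0 ?mset0D.
Qed.

Lemma econs_bagS x b : econs mset0 (ebag x b) = ebag x.+1 b.
Proof. by apply: functional_extensionality => -[]. Qed.

Lemma econs_inj b1 b2 e1 e2 : econs b1 e1 = econs b2 e2 -> b1 = b2 /\ e1 = e2.
Proof.
move=> E; split; first exact: (congr1 (@^~ 0) E).
by apply: functional_extensionality => n; apply: (congr1 (@^~ n.+1) E).
Qed.

Lemma econs_split b e e1 e2 : econs b e = eadd e1 e2 ->
  exists b1 b2 f1 f2, [/\ e1 = econs b1 f1, e2 = econs b2 f2,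
    b = b1 `+` b2 & e = eadd f1 f2].
Proof.
rewrite (econs_eta e1) (econs_eta e2) -econsD => /econs_inj[-> ->].
by do 4!eexists; split.
Qed.

Lemma ebag1_splitl x beta e e1 e2 :
  beta \in e1 x -> eadd (ebag x [mset beta]) e = eadd e1 e2 ->
  exists f, e1 = eadd (ebag x [mset beta]) f /\ e = eadd f e2.
Proof.
move=> be1 E; exists (fun n => if n == x then e1 x `\ beta else e1 n).
have E1 : e1 = eadd (ebag x [mset beta])
    (fun n => if n == x then e1 x `\ beta else e1 n).
  apply: functional_extensionality => n; rewrite /eadd /ebag.
  by case: eqP => [->|_]; rewrite ?mset0D // msetB1K.
split=> //; apply: (@eaddI (ebag x [mset beta])).
by rewrite E {1}E1 eaddA.
Qed.

(** The counterpart for environments of linear substitution into an application: the one element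
    [beta] singled out at [x] belongs either to the function part or to the bag part. *)
Lemma ebag1_split x beta e e1 e2 :
  eadd (ebag x [mset beta]) e = eadd e1 e2 ->
  (exists f, e1 = eadd (ebag x [mset beta]) f /\ e = eadd f e2) \/
  (exists f, e2 = eadd (ebag x [mset beta]) f /\ e = eadd e1 f).
Proof.
move=> E; have : beta \in eadd e1 e2 x.
  by rewrite -E /eadd /ebag eqxx mset1D1.
rewrite in_msetD => /orP[b1|b2]; first by left; apply: ebag1_splitl.
right; have [f [-> ->]] := ebag1_splitl b2 (etrans E (eaddC _ _)).
by exists f; split=> //; apply: eaddC.
Qed.

Lemma ebag1_eq x y alpha beta e :
  ebag y [mset alpha] = eadd (ebag x [mset beta]) e ->
  [/\ y = x, alpha = beta & e = env0].
Proof.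
move=> E; have : beta \in ebag y [mset alpha] x.
  by rewrite E /eadd /ebag eqxx mset1D1.
rewrite /ebag; case: eqP => [xy|]; last by rewrite in_mset0.
rewrite in_mset1 => /eqP ab; split=> //.
by apply/esym/(@eaddI (ebag y [mset alpha])); rewrite eadd0 {1}E ab xy.
Qed.

(** * The interpretation with environments *)

(** The relation [T] is a parameter so that [ty] can recurse through bags. *)
Fixpoint bty (T : term -> env -> dom -> Prop) (P : bag) (e : env)
    (b : {mset dom}) : Prop :=
  if P is L :: P' then
    exists e1 e2 beta b',
      [/\ e = eadd e1 e2, b = beta +` b', T L e1 beta & bty T P' e2 b']
  else e = env0 /\ b = mset0.

Fixpoint ty (M : term) (e : env) (alpha : dom) : Prop :=
  match M with
  | Var y => e = ebag y [mset alpha]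
  | Lam M => exists b beta, alpha = dcons b beta /\ ty M (econs b e) beta
  | App M P =>
      exists e1 e2 b,
        [/\ e = eadd e1 e2, ty M e1 (dcons b alpha) & bty ty P e2 b]
  end.

Lemma ty_app M P e1 e2 b alpha :
  ty M e1 (dcons b alpha) -> bty ty P e2 b -> ty (App M P) (eadd e1 e2) alpha.
Proof. by move=> hM hP; exists e1, e2, b. Qed.

Lemma ty_lam M e b alpha : ty M (econs b e) alpha -> ty (Lam M) e (dcons b alpha).
Proof. by exists b, alpha. Qed.

Lemma bty_cons T L P e1 e2 beta b :
  T L e1 beta -> bty T P e2 b -> bty T (L :: P) (eadd e1 e2) (beta +` b).
Proof. by exists e1, e2, beta, b. Qed.

Lemma bty1 T L e beta : bty T [:: L] e [mset beta] <-> T L e beta.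
Proof.
split=> [[e1 [e2 [gamma [b [-> /esym E h [-> b0]]]]]]|h].
  have : beta \in gamma +` b by rewrite E mset11.
  by rewrite b0 msetD0 in_mset1 => /eqP ->; rewrite eadd0.
by rewrite -[e]eadd0 -[[mset beta]]msetD0; apply: bty_cons.
Qed.

Lemma bty_cat T P Q e b :
  bty T (P ++ Q) e b <-> exists e1 e2 b1 b2,
    [/\ e = eadd e1 e2, b = b1 `+` b2, bty T P e1 b1 & bty T Q e2 b2].
Proof.
elim: P e b => [|L P IH] e b /=.
  split=> [h|[_ [e2 [_ [b2 [-> -> [-> ->]]]]]]]; last by rewrite eadd0e mset0D.
  by exists env0, e, mset0, b; rewrite eadd0e mset0D.
split=> [[e1 [e2 [beta [b' [-> -> h /IH]]]]]|].
  move=> [f1 [f2 [b1 [b2 [-> -> h1 h2]]]]].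
  exists (eadd e1 f1), f2, (beta +` b1), b2; rewrite eaddA msetDA; split=> //.
  exact: bty_cons.
move=> [_ [f2 [_ [b2 [-> -> [e1 [f1 [beta [b1 [-> -> h h1]]]]] h2]]]]].
rewrite -eaddA -msetDA; apply: bty_cons => //; apply/IH.
by exists f1, f2, b1, b2.
Qed.


Lemma bty_perm T P Q e b : perm_eq P Q -> bty T P e b -> bty T Q e b.
Proof.
elim: P Q e b => [|L P IH] Q e b; first by rewrite perm_sym => /perm_nilP ->.
move=> PQ; have LQ : L \in Q by rewrite -(perm_mem PQ) mem_head.
move: PQ; case/splitPr: LQ => Q1 Q2.
rewrite perm_sym -cat1s perm_catCA /= perm_cons perm_sym => PQ.
move=> [e1 [e2 [beta [b' [-> -> h1 /(IH _ _ _ PQ)]]]]].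
move/bty_cat=> [f1 [f2 [b1 [b2 [-> -> hP1 hP2]]]]]; apply/bty_cat.
exists f1, (eadd e1 f2), b1, (beta +` b2); rewrite eaddCA msetDCA; split=> //.
exact: bty_cons.
Qed.

Lemma ty_teq M N e alpha : teq M N -> ty M e alpha -> ty N e alpha.
Proof.
move=> MN; elim: MN e alpha => {M N} //= [M N K _ IH1 _ IH2|M P Q PQ|M N _ IH|
    M N P _ IH|M P L L' Q _ IH] e alpha.
- by move=> /IH1 /IH2.
- by move=> [e1 [e2 [b [-> h /(bty_perm PQ) hP]]]]; apply: ty_app hP.
- by move=> [b [beta [-> /IH h]]]; apply: ty_lam.
- by move=> [e1 [e2 [b [-> /IH h hP]]]]; apply: ty_app hP.
move=> [e1 [e2 [b [-> h /bty_cat hb]]]]; move: hb h.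
move=> [f1 [f2 [b1 [b2 [-> -> hP [g1 [g2 [beta [b3 [-> -> /IH hL hQ]]]]]]]]]] h.
apply: ty_app h _; apply/bty_cat; exists f1, (eadd g1 g2), b1, (beta +` b3).
by split=> //; apply: bty_cons.
Qed.

(* Resource terms are linear, so an environment sees exactly the free
   variables. *)
Lemma ty_free M e alpha x : ty M e alpha -> free x M = (e x != mset0).
Proof.
elim/term_ind_mem: M e alpha x => /= [y|M IH|M P IHM IHP] e alpha x.
- move=> ->; rewrite /ebag eq_sym; case: eqP => [_|_]; last by rewrite eqxx.
  by rewrite -size_mset_eq0 enum_msetn.
- by move=> [b [beta [_ /IH ->]]].
move=> [e1 [e2 [b [-> /IHM -> hP]]]]; rewrite msetD_eq0 negb_and; congr orb.
elim: P e2 b hP IHP => [|L P IH] e2 b /=; first by move=> [-> _]; rewrite eqxx.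
move=> [f1 [f2 [beta [b' [-> _ hL /IH hP]]]]] H.
rewrite msetD_eq0 negb_and (H _ _ _ _ _ hL) ?mem_head // hP // => K KP.
by apply: H; rewrite inE KP orbT.
Qed.

Lemma ty_closed M alpha x : ty M env0 alpha -> ~~ free x M.
Proof. by move/ty_free ->; rewrite eqxx. Qed.

(** * Renaming *)

(** Direct image of [e] along an injection [f] with left inverse [g]; the test decides whether [y]
    lies in the image of [f]. *)
Definition epush (f g : nat -> nat) (e : env) : env :=
  fun y => if f (g y) == y then e (g y) else mset0.

Lemma up_cancel f g : cancel f g -> cancel (up f) (up g).
Proof. by move=> fg [|n] //=; rewrite fg. Qed.

Lemma epush_bag f g y b : cancel f g -> epush f g (ebag y b) = ebag (f y) b.
Proof.
move=> fg; apply: functional_extensionality => n; rewrite /epush /ebag.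
case: (n =P f y) => [->|ne]; first by rewrite fg !eqxx.
by case: eqP => // E; case: eqP => // E'; case: ne; rewrite -E E'.
Qed.

Lemma epush_add f g e1 e2 :
  epush f g (eadd e1 e2) = eadd (epush f g e1) (epush f g e2).
Proof.
apply: functional_extensionality => n; rewrite /epush /eadd.
by case: eqP; rewrite ?msetD0.
Qed.

Lemma epush_up f g b e :
  epush (up f) (up g) (econs b e) = econs b (epush f g e).
Proof. by apply: functional_extensionality => -[]. Qed.

Lemma epush0 f g : epush f g env0 = env0.
Proof. by apply: functional_extensionality => n; rewrite /epush if_same. Qed.

(** Injectivity of [f] keeps the multisets of distinct variables apart, so a typing of the renamed
    term can be pulled back. *)
Lemma ty_ren f g M e alpha : cancel f g ->
  ty (ren f M) e alpha <-> exists2 e', e = epush f g e' & ty M e' alpha.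
Proof.
elim/term_ind_mem: M f g e alpha => /= [y|M IH|M P IHM IHP] f g e alpha fg.
- split=> [->|[_ -> ->]]; last by rewrite epush_bag.
  by exists (ebag y [mset alpha]); rewrite ?epush_bag.
- split=> [[b [beta [-> /(IH _ _ _ _ (up_cancel fg))]]]|].
    move=> [e']; rewrite (econs_eta e') epush_up => /econs_inj[-> ->] h.
    by eexists => //; apply: ty_lam.
  move=> [e' -> [b [beta [-> h]]]]; apply: ty_lam.
  by apply/(IH _ _ _ _ (up_cancel fg)); exists (econs b e'); rewrite ?epush_up.
have {}IHP e2 b : bty ty (map (ren f) P) e2 b <->
    exists2 e', e2 = epush f g e' & bty ty P e' b.
  elim: P e2 b IHP => [|L P IH] e2 b /= H.
    split=> [[-> ->]|[_ -> [-> ->]]]; last by rewrite epush0.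
    by exists env0; rewrite ?epush0.
  have {}IH e' b' := IH e' b' (fun K KP => H K (mem_behead (s := L :: P) KP)).
  split=> [[e1 [e3 [beta [b' [-> ->]]]]]|].
    move=> /(H _ (mem_head _ _) _ _ _ _ fg)[f1 -> h1] /IH[f2 -> h2].
    by exists (eadd f1 f2); rewrite ?epush_add //; apply: bty_cons.
  move=> [_ -> [e1 [e3 [beta [b' [-> -> h1 h2]]]]]]; rewrite epush_add.
  apply: bty_cons; last by apply/IH; exists e3.
  by apply/(H _ (mem_head _ _) _ _ _ _ fg); exists e1.
split=> [[e1 [e2 [b [-> /(IHM _ _ _ _ fg)[f1 -> h1] /IHP[f2 -> h2]]]]]|].
  by exists (eadd f1 f2); rewrite ?epush_add //; apply: ty_app h2.
move=> [_ -> [e1 [e2 [b [-> h1 h2]]]]]; rewrite epush_add; apply: (ty_app (b := b)).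
  by apply/(IHM _ _ _ _ fg); exists e1.
by apply/IHP; exists e2.
Qed.

Lemma epush_succ e : epush succn predn e = econs mset0 e.
Proof. by apply: functional_extensionality => -[|n]; rewrite /epush //= eqxx. Qed.

Lemma ty_shift M e alpha :
  ty (ren succn M) e alpha <-> exists2 e', e = econs mset0 e' & ty M e' alpha.
Proof.
rewrite (ty_ren _ _ _ succnK).
by split=> -[e' -> h]; exists e'; rewrite ?epush_succ.
Qed.

Lemma bty_shift P e b :
  bty ty (map (ren succn) P) e b <->
  exists2 e', e = econs mset0 e' & bty ty P e' b.
Proof.
elim: P e b => [|L P IH] e b /=.
  split=> [[-> ->]|[_ -> [-> ->]]]; last by rewrite econs0.
  by exists env0; rewrite ?econs0.
have E e1 e2 : econs mset0 (eadd e1 e2) = eadd (econs mset0 e1) (econs mset0 e2).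
  by rewrite -econsD msetD0.
split=> [[e1 [e2 [beta [b' [-> -> /ty_shift[f1 -> h1] /IH[f2 -> h2]]]]]]|].
  by exists (eadd f1 f2); rewrite ?E //; apply: bty_cons.
move=> [_ -> [e1 [e2 [beta [b' [-> -> h1 h2]]]]]]; rewrite E.
by apply: bty_cons; [apply/ty_shift; exists e1 | apply/IH; exists e2].
Qed.

Lemma ren_cancel f h M : (forall x, free x M -> f (h x) = x) ->
  ren f (ren h M) = M.
Proof.
elim/term_ind_mem: M f h => /= [y|M IH|M P IHM IHP] f h H.
- by rewrite H.
- by rewrite IH // => -[|x] //= /H ->.
rewrite IHM => [|x Mx]; last by rewrite H ?Mx.
rewrite -map_comp map_id_in // => L LP /=; apply: IHP => // x Lx.
by apply: H; apply/orP; right; apply/hasP; exists L.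
Qed.

Lemma free_ren y f M : free y (ren f M) -> exists2 x, free x M & f x = y.
Proof.
elim/term_ind_mem: M f y => /= [x|M IH|M P IHM IHP] f y.
- by move=> /eqP <-; exists x.
- by move=> /IH[[|x] Mx //= [<-]]; exists x.
case/orP=> [/IHM[x Mx <-]|]; first by exists x; rewrite ?Mx.
rewrite has_map => /hasP[L LP /(IHP _ LP)[x Lx <-]]; exists x => //.
by apply/orP; right; apply/hasP; exists L.
Qed.

(** * Soundness of reduction *)

Definition sty (S : tsum) (e : env) (alpha : dom) : Prop :=
  exists2 M, M \in S & ty M e alpha.

Lemma sty_cat S T e alpha : sty (S ++ T) e alpha <-> sty S e alpha \/ sty T e alpha.
Proof.
split=> [[M]|[[M MS h]|[M MT h]]].
- by rewrite mem_cat => /orP[MS|MT] h; [left|right]; exists M.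
- by exists M; rewrite // mem_cat MS.
by exists M; rewrite // mem_cat MT orbT.
Qed.

Lemma sty1 M e alpha : sty [:: M] e alpha <-> ty M e alpha.
Proof. by split=> [[N]|h]; [rewrite inE => /eqP -> | exists M; rewrite ?inE]. Qed.

Lemma sty_map (T : eqType) (f : T -> term) (S : seq T) e alpha :
  sty (map f S) e alpha <-> exists2 M, M \in S & ty (f M) e alpha.
Proof.
split=> [[_ /mapP[M MS ->]]|[M MS]] h; first by exists M.
by exists (f M); rewrite ?map_f.
Qed.

(** The bag case of [ty_lsubst], with [f] and [R] abstract so that the induction on terms can supply
    the hypothesis on elements. The element of [P] whose environment contains [beta] is the one to
    be replaced. *)
Lemma bty_apply1 f P x (R : env -> dom -> Prop) e b :
  (forall L e' alpha, L \in P -> sty (f L) e' alpha <->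
     exists e1 e2 beta, [/\ e' = eadd e1 e2,
       ty L (eadd (ebag x [mset beta]) e1) alpha & R e2 beta]) ->
  (exists2 Q, Q \in bag_apply1 f P & bty ty Q e b) <->
  exists e1 e2 beta, [/\ e = eadd e1 e2,
    bty ty P (eadd (ebag x [mset beta]) e1) b & R e2 beta].
Proof.
elim: P e b => [|L P IH] e b H /=.
  split=> [[]//|[e1 [e2 [beta [_ [E _] _]]]]].
  have : beta \in env0 x by rewrite -E /eadd /ebag eqxx mset1D1.
  by rewrite in_mset0.
have {}IH e' b' := IH e' b' (fun K e' alpha (KP : K \in P) =>
  H K e' alpha (mem_behead (s := L :: P) KP)).
have {}H := H L _ _ (mem_head _ _).
split=> [[Q]|
  [e1 [e2 [beta [-> [f1 [f2 [gamma [b' [/ebag1_split E -> hL hP]]]]] hN]]]]].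
  rewrite mem_cat => /orP[/mapP[L' LL' ->]|/mapP[P' PP' ->]] /=.
    move=> [e1 [e2 [beta [b' [-> -> hL hP]]]]].
    have /H[f1 [f2 [gamma [-> hf1 hf2]]]] : sty (f L) e1 beta by exists L'.
    exists (eadd f1 e2), f2, gamma; split=> //; first by rewrite eaddAC.
    by rewrite eaddA; apply: bty_cons.
  move=> [e1 [e2 [beta [b' [-> -> hL hP]]]]].
  have /IH[f1 [f2 [gamma [-> hf1 hf2]]]] :
    exists2 Q, Q \in bag_apply1 f P & bty ty Q e2 b' by exists P'.
  exists (eadd e1 f1), f2, gamma; split=> //; first by rewrite eaddA.
  by rewrite eaddCA; apply: bty_cons.
case: E => -[g [Eg ->]].
  have /H[L' LL' hL'] : exists e1 e3 delta, [/\ eadd g e2 = eadd e1 e3,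
      ty L (eadd (ebag x [mset delta]) e1) gamma & R e3 delta].
    by exists g, e2, beta; rewrite -Eg.
  exists (L' :: P); first by rewrite mem_cat map_f.
  by rewrite eaddAC; apply: bty_cons.
have /IH[P' PP' hP'] : exists e1 e3 delta, [/\ eadd g e2 = eadd e1 e3,
    bty ty P (eadd (ebag x [mset delta]) e1) b' & R e3 delta].
  by exists g, e2, beta; rewrite -Eg.
exists (L :: P'); first by rewrite mem_cat map_f ?orbT.
by rewrite -eaddA; apply: bty_cons.
Qed.

(** Exactly one occurrence of [x] is replaced, and it carries exactly one type [beta], which becomes
    the type of [N]. Nothing is copied or erased, hence an equivalence. *)
Lemma ty_lsubst x N M e alpha :
  sty (lsubst x N M) e alpha <->
  exists e1 e2 beta, [/\ e = eadd e1 e2,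
    ty M (eadd (ebag x [mset beta]) e1) alpha & ty N e2 beta].
Proof.
elim/term_ind_mem: M x N e alpha => /= [y|M IH|M P IHM IHP] x N e alpha.
- split=> [|[e1 [e2 [beta [-> /esym/ebag1_eq[-> -> ->] h]]]]].
    case: eqP => [->|_] [K //]; rewrite inE => /eqP -> h.
    by exists env0, e, alpha; rewrite eadd0 eadd0e.
  by rewrite eqxx eadd0e; apply/sty1.
- have E b e' beta : eadd (ebag x.+1 [mset beta]) (econs b e') =
      econs b (eadd (ebag x [mset beta]) e').
    by rewrite -econs_bagS -econsD mset0D.
  rewrite sty_map /=; split=> [[K MK [b [gamma [-> h]]]]|].
    have /IH[e1 [e2 [beta [/econs_split[b1 [b2 [f1 [f2 [-> -> -> ->]]]]]]]]] :
      sty (lsubst x.+1 (ren succn N) M) (econs b e) gamma by exists K.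
    move=> h1 /ty_shift[f3 /econs_inj[-> ->] h3]; exists f1, f3, beta.
    by rewrite msetD0; split=> //; apply: ty_lam; rewrite -E.
  move=> [e1 [e2 [beta [-> [b [gamma [-> h1]]] h2]]]].
  have /IH[K MK h] : exists f1 f2 delta, [/\ econs b (eadd e1 e2) = eadd f1 f2,
      ty M (eadd (ebag x.+1 [mset delta]) f1) gamma &
      ty (ren succn N) f2 delta].
    exists (econs b e1), (econs mset0 e2), beta; rewrite E -econsD msetD0.
    by split=> //; apply/ty_shift; exists e2.
  by exists K => //; apply: ty_lam.
have {}IHP e' b := bty_apply1 e' b
  (fun L e'' beta LP => IHP L LP x N e'' beta).
rewrite sty_cat !sty_map /=; split=> [[[K MK]|[Q PQ]] [e1 [e2 [b [-> h1 h2]]]]|].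
- have /IHM[f1 [f2 [beta [-> hf1 hf2]]]] : sty (lsubst x N M) e1 (dcons b alpha).
    by exists K.
  exists (eadd f1 e2), f2, beta; split=> //; first by rewrite eaddAC.
  by rewrite eaddA; apply: ty_app h2.
- have /IHP[f1 [f2 [beta [-> hf1 hf2]]]] :
      exists2 Q, Q \in bag_apply1 (lsubst x N) P & bty ty Q e2 b by exists Q.
  exists (eadd e1 f1), f2, beta; split=> //; first by rewrite eaddA.
  by rewrite eaddCA; apply: ty_app hf1.
move=> [e1 [e2 [beta [-> [f1 [f2 [b [/ebag1_split E h1 h2]]]] hN]]]].
case: E => -[g [Eg ->]]; [left|right].
  have /IHM[K MK hK] : exists e1 e3 delta, [/\ eadd g e2 = eadd e1 e3,
      ty M (eadd (ebag x [mset delta]) e1) (dcons b alpha) & ty N e3 delta].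
    by exists g, e2, beta; rewrite -Eg.
  by exists K => //; rewrite eaddAC; apply: ty_app h2.
have /IHP[Q PQ hQ] : exists e1 e3 delta, [/\ eadd g e2 = eadd e1 e3,
    bty ty P (eadd (ebag x [mset delta]) e1) b & ty N e3 delta].
  by exists g, e2, beta; rewrite -Eg.
by exists Q => //; rewrite -eaddA; apply: ty_app hQ.
Qed.

Lemma sty_lsubst_sum x N S e alpha :
  sty (lsubst_sum x S N) e alpha <->
  exists e1 e2 beta, [/\ e = eadd e1 e2,
    sty S (eadd (ebag x [mset beta]) e1) alpha & ty N e2 beta].
Proof.
split=> [[K /flattenP[_ /mapP[M MS ->] MK] h]|].
  have /ty_lsubst[e1 [e2 [beta [-> h1 h2]]]] : sty (lsubst x N M) e alpha.
    by exists K.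
  by exists e1, e2, beta; split=> //; exists M.
move=> [e1 [e2 [beta [-> [M MS h1] h2]]]].
have /ty_lsubst[K MK h] : exists f1 f2 delta, [/\ eadd e1 e2 = eadd f1 f2,
    ty M (eadd (ebag x [mset delta]) f1) alpha & ty N f2 delta].
  by exists e1, e2, beta.
by exists K => //; apply/flattenP; exists (lsubst x N M); rewrite // map_f.
Qed.

Lemma sty_lsubst_bag x P S e alpha :
  (forall L, L \in P -> ~~ free x L) ->
  sty (foldl (lsubst_sum x) S P) e alpha <->
  exists e1 e2 b, [/\ e = eadd e1 e2,
    sty S (eadd (ebag x b) e1) alpha & bty ty P e2 b].
Proof.
elim: P S e => [|L P IH] S e H /=.
  split=> [h|[e1 [e2 [b [-> h [-> Eb]]]]]].
    by exists e, env0, mset0; rewrite ebag0 eadd0 eadd0e.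
  by move: h; rewrite Eb ebag0 eadd0 eadd0e.
rewrite IH => [|K KP]; last by rewrite H // inE KP orbT.
split=> [[e1 [e2 [b [-> /sty_lsubst_sum[f1 [f2 [beta [E h1 h2]]]] hP]]]]|].
  (* As [x] is not free in [L], [f2] is empty at [x], so the whole of [b] comes from [f1]. *)
  have {E} [f [Ef ->]] : exists f, f1 = eadd (ebag x b) f /\ e1 = eadd f f2.
    have f2x : f2 x = mset0.
      by apply/eqP; have := H L (mem_head _ _); rewrite (ty_free _ h2) negbK.
    exists (fun n => if n == x then e1 x else f1 n).
    split; apply: functional_extensionality => n;
      have := congr1 (@^~ n) E; rewrite /eadd /ebag;
      by case: eqP => [->|_]; rewrite ?f2x ?msetD0 ?mset0D.
  exists f, (eadd f2 e2), (beta +` b); rewrite eaddA; split=> //.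
    by rewrite ebagD -eaddA -Ef.
  exact: bty_cons.
move=> [e1 [e2 [b0 [-> h hP]]]]; move: hP h.
move=> [f1 [f2 [beta [b [-> -> h1 h2]]]]] h.
exists (eadd e1 f1), f2, b; rewrite eaddA; split=> //.
apply/sty_lsubst_sum; exists (eadd (ebag x b) e1), f1, beta; rewrite -eaddA.
by split=> //; rewrite eaddA -ebagD.
Qed.

Lemma free_shift M : ~~ free 0 (ren succn M).
Proof. by apply/negP => /free_ren[]. Qed.

Lemma sty_beta M P e alpha :
  sty (beta M P) e alpha <->
  exists e1 e2 b, [/\ e = eadd e1 e2, ty M (econs b e1) alpha & bty ty P e2 b].
Proof.
(* Filtering and lowering indices do not affect the typings concerned: the empty multiset at index 0
   means that 0 is not free, and then [predn] is undone by [succn]. *)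
have -> : sty (beta M P) e alpha <->
    sty (lsubst_bag 0 M (map (ren succn) P)) (econs mset0 e) alpha.
  rewrite sty_map; split=> -[K].
    rewrite mem_filter => /andP[K0 MK] h; exists K => //.
    have <- : ren succn (ren predn K) = K.
      by apply: ren_cancel => -[|x] //; rewrite (negPf K0).
    by apply/ty_shift; exists e.
  move=> MK h; have K0 : ~~ free 0 K by rewrite (ty_free 0 h) negbK.
  exists K; first by rewrite mem_filter K0.
  have EK : ren succn (ren predn K) = K.
    by apply: ren_cancel => -[|x] //; rewrite (negPf K0).
  by move: h; rewrite -{1}EK => /ty_shift[e' /econs_inj[_ ->]].
rewrite sty_lsubst_bag => [|_ /mapP[L _ ->]]; last exact: free_shift.
split=> [[e1 [e2 [b [E /sty1 h1 /bty_shift[f2 Ef2 h2]]]]]|].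
  move: E; rewrite Ef2 (econs_eta e1) -econsD msetD0 => /econs_inj[E0 ->].
  exists (fun n => e1 n.+1), f2, b; split=> //.
  by rewrite econs_bag0 E0 -econs_eta.
move=> [e1 [e2 [b [-> h1 h2]]]].
exists (econs mset0 e1), (econs mset0 e2), b; rewrite -econsD msetD0 -econs_bag0.
by split=> //; [apply/sty1 | apply/bty_shift; exists e2].
Qed.

(** Subject reduction and expansion at once. In the redex case, [dcons_inj] identifies the multiset
    of the bound variable with the one typing the bag. *)
Lemma ty_red M S e alpha : red M S -> ty M e alpha <-> sty S e alpha.
Proof.
move=> MS; elim: MS e alpha => {M S}
  [M P|M S _ IH|M P S _ IH|M P L Q S _ IH] e alpha.
- rewrite sty_beta /=; split.
    move=> [e1 [e2 [b [-> [b' [alpha' [/dcons_inj[<- <-] h1]]]]]]].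
    by exists e1, e2, b.
  by move=> [e1 [e2 [b [-> h1 h2]]]]; exists e1, e2, b; split=> //; exact: ty_lam.
- rewrite sty_map /=; split=> [[b [beta [-> /IH[N NS h]]]]|].
    by exists N => //; apply: ty_lam.
  move=> [N NS [b [beta [-> h]]]]; apply: ty_lam; apply/IH.
  by exists N.
- rewrite sty_map /=; split=> [[e1 [e2 [b [-> /IH[N NS h] hP]]]]|].
    by exists N => //; apply: ty_app hP.
  move=> [N NS [e1 [e2 [b [-> h hP]]]]]; apply: ty_app hP; apply/IH.
  by exists N.
rewrite sty_map /=; split=> [[e1 [e2 [b [-> h /bty_cat hb]]]]|[N NS]].
  move: hb h => [f1 [f2 [b1 [b2 [-> -> hP]]]]].
  move=> [g1 [g2 [beta [b3 [-> -> /IH[N NS hN] hQ]]]]] h.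
  exists N => //; apply: ty_app h _; apply/bty_cat.
  exists f1, (eadd g1 g2), b1, (beta +` b3); split=> //; exact: bty_cons.
move=> [e1 [e2 [b [-> h /bty_cat hb]]]].
move: hb h => [f1 [f2 [b1 [b2 [-> -> hP]]]]].
move=> [g1 [g2 [beta [b3 [-> -> hN hQ]]]]] h.
apply: ty_app h _; apply/bty_cat.
exists f1, (eadd g1 g2), b1, (beta +` b3); split=> //; apply: bty_cons => //.
by apply/IH; exists N.
Qed.

Lemma sty_eq S T e alpha : Defs.sum_eq S T -> sty S e alpha <-> sty T e alpha.
Proof.
move=> [ST TS]; split=> [[M /ST[N NT MN] h]|[N /TS[M MS MN] h]].
  by exists N => //; apply: ty_teq h.
by exists M => //; apply: ty_teq h; apply: teq_sym.
Qed.

Lemma sty_reds S T e alpha : sum_reds S T -> sty S e alpha <-> sty T e alpha.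
Proof.
elim=> {S T} [S T /sty_eq|S T U [M [S' [V [/sty_eq -> MS /sty_eq E]]]] _ <-] //.
by rewrite E -cat1s !sty_cat sty1 (ty_red _ _ MS).
Qed.

(** * Comparison with the interpretation over a list of variables *)

Lemma tuple_add_map e1 e2 xs :
  tuple_add (map e1 xs) (map e2 xs) = map (eadd e1 e2) xs.
Proof. by elim: xs => //= x xs; rewrite /tuple_add => /= ->. Qed.

Lemma map_env0 xs : map env0 xs = nseq (size xs) mset0.
Proof. by elim: xs => //= x xs ->. Qed.

Lemma map_econs b e xs :
  map (econs b e) (rcons (map succn xs) 0) = rcons (map e xs) b.
Proof. by rewrite map_rcons -map_comp. Qed.

Lemma interp_ty xs M a alpha :
  interp xs M a alpha -> exists2 e, a = map e xs & ty M e alpha.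
Proof.
elim/term_ind_mem: M xs a alpha => /= [y|M IH|M P IHM IHP] xs a alpha.
- by move=> [_ ->]; exists (ebag y [mset alpha]).
- move=> [b [beta [-> /IH[e]]]]; rewrite (econs_eta e) map_econs.
  by move=> /rcons_inj[-> ->] h; eexists => //; apply: ty_lam.
move=> [a1 [a2 [b [-> /IHM[e1 -> h1] hP]]]].
suff [e2 -> h2] : exists2 e2, a2 = map e2 xs & bty ty P e2 b.
  by exists (eadd e1 e2); [rewrite tuple_add_map | apply: ty_app h2].
elim: P a2 b {h1} hP IHP => [|L P IH] a2 b /= hP H.
  by case: hP => -> ->; exists env0; rewrite ?map_env0.
move: hP => [f1 [f2 [beta [b' [-> -> /(H _ (mem_head _ _))[g1 -> h1] hP]]]]].
have [K KP|g2 -> h2] := IH _ _ hP; first by apply: H; rewrite inE KP orbT.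
by exists (eadd g1 g2); [rewrite tuple_add_map | apply: bty_cons].
Qed.

Lemma ty_interp xs M e alpha :
  (forall x, free x M -> x \in xs) -> ty M e alpha ->
  interp xs M (map e xs) alpha.
Proof.
elim/term_ind_mem: M xs e alpha => /= [y|M IH|M P IHM IHP] xs e alpha H.
- by move=> ->; split=> //; apply: H.
- move=> [b [beta [-> h]]]; exists b, beta; split=> //; rewrite -map_econs.
  apply: IH h => -[|x] Mx; rewrite mem_rcons inE //.
  by rewrite (mem_map succn_inj) H.
move=> [e1 [e2 [b [-> h1 hP]]]]; exists (map e1 xs), (map e2 xs), b.
rewrite tuple_add_map; split=> //; first by apply: IHM => // x Mx; rewrite H ?Mx.
have {H} : forall x, has (free x) P -> x \in xs by move=> x Px; rewrite H ?Px ?orbT.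
elim: P e2 b hP IHP {h1} => [|L P IH] e2 b /=.
  by move=> [-> ->]; rewrite map_env0.
move=> [f1 [f2 [beta [b' [-> -> hL hP]]]]] H Hx.
exists (map f1 xs), (map f2 xs), beta, b'; rewrite tuple_add_map; split=> //.
  by apply: (H _ (mem_head _ _)) hL => x Lx; rewrite Hx ?Lx.
apply: IH => // [K KP|x Px]; first by apply: H; rewrite inE KP orbT.
by rewrite Hx ?Px ?orbT.
Qed.

(** * Reduction of sums *)

Lemma sum_eq_refl S : Defs.sum_eq S S.
Proof. by split=> M MS; exists M => //; apply: teq_refl. Qed.

Lemma sum_eq_trans S T U : Defs.sum_eq S T -> Defs.sum_eq T U -> Defs.sum_eq S U.
Proof.
move=> [ST TS] [TU UT]; split=> [M /ST[N /TU[K KU NK] MN]|K /UT[N /TS[M MS MN] NK]].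
  by exists K => //; apply: teq_trans NK.
by exists M => //; apply: teq_trans NK.
Qed.

Lemma sum_eq_mem S T : S =i T -> Defs.sum_eq S T.
Proof.
by move=> ST; split=> M MS; exists M; rewrite ?ST // -?ST //; apply: teq_refl.
Qed.

Lemma sum_eq_cat S T U : Defs.sum_eq S T -> Defs.sum_eq (S ++ U) (T ++ U).
Proof.
move=> [ST TS]; split=> M; rewrite mem_cat => /orP[].
- by move=> /ST[N NT MN]; exists N; rewrite // mem_cat NT.
- by move=> MU; exists M; [rewrite mem_cat MU orbT | apply: teq_refl].
- by move=> /TS[N NS MN]; exists N; rewrite // mem_cat NS.
by move=> MU; exists M; [rewrite mem_cat MU orbT | apply: teq_refl].
Qed.

Lemma sum_eq_reds S T U : Defs.sum_eq S T -> sum_reds T U -> sum_reds S U.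
Proof.
move=> ST TU; case: TU ST => [{}T {}U TU ST|{}T V {}U [M [S' [W [TM MS VS]]]] VU ST].
  exact/sum_reds_refl/(sum_eq_trans ST).
apply: sum_reds_step VU; exists M, S', W; split=> //.
exact: sum_eq_trans TM.
Qed.

Lemma sum_reds_trans S T U : sum_reds S T -> sum_reds T U -> sum_reds S U.
Proof.
elim=> {S T} [S T ST|S T V ST _ IH /IH]; first exact: sum_eq_reds.
exact: sum_reds_step.
Qed.

Lemma sum_reds_cat S T U : sum_reds S T -> sum_reds (S ++ U) (T ++ U).
Proof.
elim=> {S T} [S T ST|S T V [M [S' [W [SM MS TS]]]] _].
  exact/sum_reds_refl/sum_eq_cat.
apply: sum_reds_step; exists M, S', (W ++ U); rewrite catA; split=> //.
  exact: (sum_eq_cat (T := M :: W)).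
exact: sum_eq_cat.
Qed.

Lemma red_sum_reds M S : red M S -> sum_reds [:: M] S.
Proof.
move=> MS; apply: sum_reds_step (sum_reds_refl (sum_eq_refl S)).
by exists M, S, [::]; rewrite cats0; split=> //; apply: sum_eq_refl.
Qed.

Lemma sum_reds_collect (p : term -> Prop) S :
  (forall M, M \in S ->
     exists2 T, sum_reds [:: M] T & forall N, N \in T -> p N) ->
  exists2 T, sum_reds S T & forall N, N \in T -> p N.
Proof.
elim: S => [|M S IH] H; first by exists [::]; first exact/sum_reds_refl/sum_eq_refl.
have [K KS|T ST pT] := IH; first by apply: H; rewrite inE KS orbT.
have [U MU pU] := H M (mem_head _ _); exists (U ++ T); last first.
  by move=> N; rewrite mem_cat => /orP[/pU|/pT].
rewrite -cat1s; apply: sum_reds_trans (sum_reds_cat S MU) _.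
(* [sum_reds_cat] reduces the front of a sum only, so the tail [S] is moved to the front, reduced
   there and moved back. *)
have swap V W : Defs.sum_eq (V ++ W) (W ++ V).
  by apply: sum_eq_mem => x; rewrite !mem_cat orbC.
apply: sum_eq_reds (swap _ _) _; apply: sum_reds_trans (sum_reds_cat U ST) _.
exact/sum_reds_refl/swap.
Qed.

(** * Sizes and free variables along reduction *)

(** The termination measure: it is additive under linear substitution, so firing a redex loses
    exactly the application of that redex. *)
Fixpoint apps (M : term) : nat :=
  match M with
  | Var _ => 0
  | Lam M => apps M
  | App M P => (apps M + sumn (map apps P)).+1
  end.

Lemma mem_bag_apply1 f P Q : Q \in bag_apply1 f P ->
  exists P1 L P2 L', [/\ P = P1 ++ L :: P2, Q = P1 ++ L' :: P2 & L' \in f L].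
Proof.
elim: P Q => //= L P IH Q; rewrite mem_cat => /orP[/mapP[L' LL' ->]|].
  by exists [::], L, P, L'.
move=> /mapP[_ /IH[P1 [K [P2 [K' [-> -> KK']]]]] ->].
by exists (L :: P1), K, P2, K'.
Qed.

Lemma apps_ren f M : apps (ren f M) = apps M.
Proof.
elim/term_ind_mem: M f => //= M P IHM IHP f; rewrite IHM -map_comp.
by congr (_ + sumn _).+1; apply/eq_in_map => L LP /=; apply: IHP.
Qed.

Lemma apps_lsubst x N M K : K \in lsubst x N M -> apps K = apps M + apps N.
Proof.
elim/term_ind_mem: M x N K => /= [y|M IH|M P IHM IHP] x N K.
- by case: eqP => // _; rewrite inE => /eqP ->.
- by move=> /mapP[K' /IH E ->] /=; rewrite E apps_ren.
rewrite mem_cat => /orP[/mapP[K' /IHM E ->]|/mapP[Q]] /=.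
  by rewrite E addnAC.
move=> /mem_bag_apply1[P1 [L [P2 [L' [EP -> LL']]]]] -> /=.
have LP : L \in P by rewrite EP mem_cat mem_head orbT.
rewrite EP !map_cat !sumn_cat /= (IHP _ LP _ _ _ LL') !addSn -!addnA.
by rewrite (addnC (apps N)) !addnA.
Qed.

Lemma apps_lsubst_bag x P S K : K \in foldl (lsubst_sum x) S P ->
  exists2 M, M \in S & apps K = apps M + sumn (map apps P).
Proof.
elim: P S K => [|L P IH] S K /= KS; first by exists K; rewrite ?addn0.
have [M' /flattenP[_ /mapP[M MS ->] /apps_lsubst E] ->] := IH _ _ KS.
by exists M; rewrite // E addnA.
Qed.

Lemma apps_beta M P K : K \in beta M P -> apps K = apps M + sumn (map apps P).
Proof.
move=> /mapP[K']; rewrite mem_filter => /andP[_ /apps_lsubst_bag[N]].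
rewrite inE => /eqP -> E ->; rewrite apps_ren E -map_comp.
by congr (_ + sumn _); apply: eq_map => L /=; rewrite apps_ren.
Qed.

Lemma apps_red M S N : red M S -> N \in S -> apps N < apps M.
Proof.
move=> MS; elim: MS N => {M S} [M P|M S _ IH|M P S _ IH|M P L Q S _ IH] N.
- by move=> /apps_beta -> /=.
- by move=> /mapP[K /IH lt ->].
- by move=> /mapP[K /IH lt ->] /=; rewrite ltnS ltn_add2r.
move=> /mapP[K /IH lt ->] /=; rewrite ltnS ltn_add2l !map_cat !sumn_cat /=.
by rewrite ltn_add2l ltn_add2r.
Qed.

Lemma free_lsubst x N M K y : K \in lsubst x N M -> free y K -> free y M || free y N.
Proof.
elim/term_ind_mem: M x N K y => /= [z|M IH|M P IHM IHP] x N K y.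
- by case: eqP => // _; rewrite inE => /eqP -> ->; rewrite orbT.
- move=> /mapP[K' MK' ->] /= /(IH _ _ _ _ MK')/orP[->//|].
  by move=> /free_ren[z Nz [<-]]; rewrite Nz orbT.
rewrite mem_cat => /orP[/mapP[K' MK' ->]|/mapP[Q]] /=.
  by case/orP=> [/(IHM _ _ _ _ MK')/orP[]|] ->; rewrite ?orbT.
move=> /mem_bag_apply1[P1 [L [P2 [L' [EP -> LL']]]]] -> /=.
have LP : L \in P by rewrite EP mem_cat mem_head orbT.
rewrite EP !has_cat /= => /orP[->//|/or3P[->|/(IHP _ LP _ _ _ _ LL')/orP[]->|->]];
  by rewrite ?orbT.
Qed.

Lemma free_lsubst_bag x P S K y : K \in foldl (lsubst_sum x) S P -> free y K ->
  has (free y) S || has (free y) P.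
Proof.
elim: P S => [|L P IH] S /= KS Ky; first by rewrite orbF; apply/hasP; exists K.
have /orP[/hasP[M' /flattenP[_ /mapP[M MS ->] MM'] My]|->] := IH _ KS Ky;
  last by rewrite !orbT.
have /orP[h|->] := free_lsubst MM' My; last by rewrite orbT.
by apply/orP; left; apply/hasP; exists M.
Qed.

Lemma free_red M S N y : red M S -> N \in S -> free y N -> free y M.
Proof.
move=> MS; elim: MS N y => {M S} [M P|M S _ IH|M P S _ IH|M P L Q S _ IH] N y.
- move=> /mapP[K]; rewrite mem_filter => /andP[K0 MK] -> /free_ren[[|z]].
    by rewrite (negPf K0).
  move=> Kz /= <-; have := free_lsubst_bag MK Kz; rewrite /= orbF.
  move=> /orP[->//|/hasP[_ /mapP[L LP ->] /free_ren[w Lw [<-]]]].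
  by apply/orP; right; apply/hasP; exists L.
- by move=> /mapP[K SK ->] /= /(IH _ _ SK).
- by move=> /mapP[K SK ->] /= /orP[/(IH _ _ SK)|] ->; rewrite ?orbT.
move=> /mapP[K SK ->] /=; rewrite !has_cat /=.
by move=> /or4P[|||] => [->|->|/(IH _ _ SK) ->|->]; rewrite ?orbT.
Qed.

(** * Normalization by the number of applications *)

Lemma normalizing M :
  exists2 T, sum_reds [:: M] T & forall N, N \in T -> normal N.
Proof.
have [k] := ubnP (apps M); elim: k M => // k IH M; rewrite ltnS => leM.
case: (classic (exists S, red M S)) => [[S MS]|nM].
  have [N NS|T ST nT] := sum_reds_collect (p := normal) (S := S).
    exact/IH/(leq_trans (apps_red MS NS)).
  by exists T => //; apply: sum_reds_trans ST; apply: red_sum_reds.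
exists [:: M]; first exact/sum_reds_refl/sum_eq_refl.
by move=> N; rewrite inE => /eqP ->.
Qed.

(** * Typing normal forms with inhabited types *)

Definition ident (delta : dom) : dom := dcons [mset delta] delta.

Lemma ty_Iterm delta : ty Iterm env0 (ident delta).
Proof. by apply: ty_lam; rewrite econs_bag0 econs0 eadd0. Qed.

Lemma ty_app1 M N e1 e2 delta alpha :
  ty M e1 (dcons [mset delta] alpha) -> ty N e2 delta ->
  ty (App M [:: N]) (eadd e1 e2) alpha.
Proof. by move=> h1 h2; apply: ty_app h1 _; apply/bty1. Qed.

(** The bags are typed in [env0], hence closed, so applying a term to them leaves its environment
    unchanged. *)
Fixpoint args (Qs : seq bag) (alpha beta : dom) : Prop :=
  if Qs is Q :: Qs' then
    exists b alpha', [/\ alpha = dcons b alpha', bty ty Q env0 b &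
      args Qs' alpha' beta]
  else alpha = beta.

Lemma ty_args Qs M e alpha beta :
  ty M e alpha -> args Qs alpha beta -> ty (foldl App M Qs) e beta.
Proof.
elim: Qs M alpha => [|Q Qs IH] M alpha /= h; first by move=> <-.
move=> [b [alpha' [E hQ]]]; apply: IH; rewrite E in h.
by rewrite -[e]eadd0; apply: ty_app hQ.
Qed.

(** The bag [s x] supplies one closed term for each type that [e] demands of [x]. *)
Definition inhabits (s : nat -> bag) (e : env) : Prop :=
  forall x, bty ty (s x) env0 (e x).

Lemma inhabits_cat s1 s2 e1 e2 : inhabits s1 e1 -> inhabits s2 e2 ->
  inhabits (fun x => s1 x ++ s2 x) (eadd e1 e2).
Proof.
move=> h1 h2 x; apply/bty_cat; exists env0, env0, (e1 x), (e2 x).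
by rewrite eadd0.
Qed.


(* The closing bags must not depend on the target type [delta]: the probe by
   identities at the end forces longer and longer identity types. *)
Definition closable (N : term) : Prop :=
  exists s Qs, forall delta, exists e alpha,
    [/\ ty N e alpha, inhabits s e & args Qs alpha (ident delta)].

(** Meant for terms with a head variable: it can receive a closed term that absorbs its arguments
    and then acts as [K]. Again [s] is chosen before the type. *)
Definition replaceable (N : term) : Prop :=
  forall K, exists s, forall kappa, ty K env0 kappa ->
    exists2 e, ty N e kappa & inhabits s e.

Definition is_lam (M : term) : bool := if M is Lam _ then true else false.

Lemma replaceable_closable N : replaceable N -> closable N.
Proof.
move=> /(_ Iterm)[s H]; exists s, [::] => delta.
by have [e h1 h2] := H _ (ty_Iterm delta); exists e, (ident delta).
Qed.

(* [C] consumes the bag bound to the index 0, testing its elements one by one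
   against the identity, and then behaves as [K]. *)
Lemma closable_bag P K : (forall L, L \in P -> closable L) ->
  exists s C, forall kappa, ty K env0 kappa -> exists e b,
    [/\ bty ty P e b, inhabits s e & ty C (ebag 0 b) kappa].
Proof.
elim: P => [|L P IH] H.
  by exists (fun=> [::]), K => kappa h; exists env0, mset0; rewrite ebag0.
have [M MP|s2 [C H2]] := IH; first by apply: H; rewrite inE MP orbT.
have [s1 [Qs H1]] := H L (mem_head _ _).
(* The element received at index 0 is applied to [Qs], which gives it the type [ident kappa]; fed
   with [C], it returns type [kappa]. The identity type varies with [kappa], hence the uniformity in
   [closable]. *)
exists (fun x => s1 x ++ s2 x), (App (foldl App (Var 0) Qs) [:: C]).
move=> kappa /[dup] h /H2[e2 [b [hP i2 hC]]].
have [e1 [alpha [hL i1 hQ]]] := H1 kappa.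
exists (eadd e1 e2), (alpha +` b); split; [exact: bty_cons|exact: inhabits_cat|].
rewrite ebagD; apply: ty_app1 hC.
exact: ty_args hQ.
Qed.

Lemma normal_closable N : normal N -> closable N.
Proof.
(* The induction needs the stronger property at function positions, which in a normal form are never
   abstractions. *)
move=> nN; suff [//] : closable N /\ (~~ is_lam N -> replaceable N).
elim/term_ind_mem: N nN => /= [y|M IH|M P IHM IHP] nN.
- suff R : replaceable (Var y) by split=> //; apply: replaceable_closable.
  move=> K; exists (fun x => if x == y then [:: K] else [::]) => kappa h.
  exists (ebag y [mset kappa]) => // x; rewrite /ebag.
  by case: eqP => // _; apply/bty1.
- split=> //; have [|[s [Qs H]] _] := IH.
    by move=> [S MS]; apply: nN; exists (map Lam S); apply: red_lam.
  (* The bag meant for the bound variable becomes the first argument. *)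
  exists (fun x => s x.+1), (s 0 :: Qs) => delta.
  have [e [alpha [h i hQ]]] := H delta.
  exists (fun x => e x.+1), (dcons (e 0) alpha); split=> //.
    by apply: ty_lam; rewrite -econs_eta.
  by exists (e 0), alpha.
suff R : replaceable (App M P) by split=> //; apply: replaceable_closable.
move=> K.
have {}IHP : exists s C, forall kappa, ty K env0 kappa -> exists e b,
    [/\ bty ty P e b, inhabits s e & ty C (ebag 0 b) kappa].
  apply: closable_bag => L LP; have [|//] := IHP L LP.
  case/splitPr: LP nN => P1 P2 nN [S LS]; apply: nN.
  by exists [seq App M (P1 ++ L' :: P2) | L' <- S]; apply: red_appr.
have {IHP} [s [C H]] := IHP.
have nM : normal M.
  by move=> [S MS]; apply: nN; exists [seq App M' P | M' <- S]; apply: red_appl.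
have lM : ~~ is_lam M.
  by apply/negP; case: M nN {IHM nM} => // M []; exists (beta M P); apply: red_beta.
(* The head of [M] is made to act as [Lam C], which takes the bag [P], tests it and continues as
   [K]. *)
have [_ /(_ lM (Lam C))[s' H']] := IHM nM.
exists (fun x => s' x ++ s x) => kappa /H[e [b [hP i hC]]].
have [|e' h' i'] := H' (dcons b kappa).
  by apply: ty_lam; rewrite econs_bag0 econs0 eadd0.
by exists (eadd e' e); [apply: ty_app hP | apply: inhabits_cat].
Qed.

(** * Probing closed terms by identities *)

Definition probe (m : nat) (G : term) : term :=
  iter m (fun M => App M [:: Iterm]) G.

Definition closed (G : term) : Prop := forall x, ~~ free x G.

(** The secondary measure, for probing an abstraction with [Iterm]: this leaves [apps] of the
    abstraction unchanged. *)
Fixpoint lead (M : term) : nat :=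
  match M with
  | Var y => y
  | Lam M => (lead M).+1
  | App _ _ => 0
  end.

Lemma lead_ren f M : (forall n, f n <= n) -> lead (ren f M) <= lead M.
Proof. by elim: M f => //= M IH f H; apply: IH => -[|n] //=; rewrite ltnS. Qed.

(** The index has to be positive because [lead Iterm] is 1. *)
Lemma lead_lsubst x M K : K \in lsubst x.+1 Iterm M -> lead K <= lead M.
Proof.
elim: M x K => [y|M IH|M _ P] x K /=.
- by case: eqP => // ->; rewrite inE => /eqP ->.
- by move=> /mapP[K' /IH le ->].
by rewrite mem_cat => /orP[] /mapP[K' _ ->].
Qed.

(* A variable counts as its index, so that the step from
   [Lam^j (Lam (Var j))] to [Lam^j Iterm] decreases as well. *)
Lemma lead_beta M K : (forall y, M <> Var y) -> K \in beta M [:: Iterm] ->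
  lead K <= lead M.
Proof.
move=> nM /mapP[K']; rewrite mem_filter /= /lsubst_bag /lsubst_sum /= cats0.
move=> /andP[_ MK'] ->; apply: (leq_trans (n := lead K')).
  by apply: lead_ren => n; apply: leq_pred.
case: M nM MK' => [y /(_ y)//|M _ /= /mapP[K'' /lead_lsubst le ->] //|M P _ /=].
by rewrite mem_cat => /orP[] /mapP[K'' _ ->].
Qed.

Lemma closed_red M S N : closed M -> red M S -> N \in S -> closed N.
Proof. by move=> cM MS NS x; apply: contra (cM x); apply: free_red NS. Qed.

(** Following function positions in a closed application ends at an abstraction, since a variable
    there would be free; its application is a redex. *)
Lemma closed_reducible M : closed M -> ~~ is_lam M -> exists S, red M S.
Proof.
elim: M => [y|M _|M IH P] //= cM _; first by have := cM y; rewrite /= eqxx.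
case: (boolP (is_lam M)) => [|nM].
  by case: M {IH} cM => // M _ _; exists (beta M P); apply: red_beta.
have [|//|S MS] := IH; first by move=> x; have /norP[] := cM x.
by exists [seq App M' P | M' <- S]; apply: red_appl.
Qed.

Lemma red_probe m M S : red M S -> red (probe m M) (map (probe m) S).
Proof.
move=> MS; elim: m => [|m IH]; first by rewrite map_id.
have -> : map (probe m.+1) S = [seq App N [:: Iterm] | N <- map (probe m) S].
  by rewrite -map_comp.
exact: red_appl.
Qed.

(** By idempotence of addition, such a [T] is either 0 or the identity. *)
Definition tame (m : nat) (G : term) : Prop :=
  exists2 T, sum_reds [:: probe m G] T & forall N, N \in T -> N = Iterm.

(** Asking for all large [m], and not for one, lets the bounds of finitely many summands be merged
    into their maximum. *)
Lemma eventually_all (Q : nat -> term -> Prop) (S : tsum) :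
  (forall N, N \in S -> exists n, forall m, n <= m -> Q m N) ->
  exists n, forall m, n <= m -> forall N, N \in S -> Q m N.
Proof.
elim: S => [|M S IH] H; first by exists 0.
have [K KS|n1 H1] := IH; first by apply: H; rewrite inE KS orbT.
have [n2 H2] := H M (mem_head _ _); exists (maxn n1 n2) => m.
rewrite geq_max => /andP[le1 le2] N.
by rewrite inE => /predU1P[->|/H1]; [apply: H2 | apply].
Qed.

Lemma tame_red m G S : red G S -> (forall N, N \in S -> tame m N) -> tame m G.
Proof.
move=> GS H; have [_ /mapP[N /H tN ->] //|T ST pT] :=
  sum_reds_collect (p := fun N => N = Iterm) (S := map (probe m) S).
by exists T => //; apply: sum_reds_trans ST; apply/red_sum_reds/red_probe.
Qed.

Lemma tame_Iterm m : tame m Iterm.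
Proof.
elim: m => [|m IH].
  exists [:: Iterm]; first exact/sum_reds_refl/sum_eq_refl.
  by move=> N; rewrite inE => /eqP.
have : tame m (App Iterm [:: Iterm]).
  apply: (tame_red (red_beta (Var 0) [:: Iterm])) => N.
  by rewrite inE => /eqP ->.
by rewrite /tame /probe iterSr.
Qed.

(* Applied to a singleton identity, a closed abstraction loses its outermost
   binder without gaining applications; any other closed term has a redex, and
   firing a redex removes an application. *)
Lemma eventually_tame G : closed G -> exists n, forall m, n <= m -> tame m G.
Proof.
(* Lexicographic induction on [apps], then [lead]. *)
have [k] := ubnP (apps G); elim: k G => // k IHk G.
have [l] := ubnP (lead G); elim: l G => // l IHl G leG akG cG.
case: (boolP (is_lam G)) => [|nG]; last first.
  have [S GS] := closed_reducible cG nG.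
  have [N NS|n H] := eventually_all (Q := tame) (S := S).
    apply: IHk (closed_red cG GS NS).
    by rewrite -ltnS; apply: leq_trans akG; apply: apps_red NS.
  by exists n => m /H; apply: tame_red.
case: G leG akG cG => // M leG akG cG _.
case: (classic (exists y, M = Var y)) => [[y EM]|nM].
  (* A positive [y] would leave [y.-1] free in the abstraction, so [G] is the identity. *)
  have := cG y.-1; rewrite EM; case: y {EM} => [_|y] /=; last by rewrite eqxx.
  by exists 0 => m _; apply: tame_Iterm.
have cA : closed (App (Lam M) [:: Iterm]).
  by move=> x; rewrite /= !orbF; apply: cG.
have [N NS|n H] := eventually_all (Q := tame) (S := beta M [:: Iterm]).
  apply: IHl.
  - apply: leq_ltn_trans (lead_beta _ NS) _; last exact: leG.
    by move=> y EM; apply: nM; exists y.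
  - by rewrite (apps_beta NS) addn0.
  exact: closed_red cA (red_beta _ _) NS.
(* One probe is spent on contracting the outermost abstraction. *)
exists n.+1 => -[|m] // /H tS.
have := tame_red (red_beta M [:: Iterm]) tS.
by rewrite /tame /probe iterSr.
Qed.

(** Each probe peels off one [ident], as [Iterm] has the argument type required; one of the [m.+2]
    layers remains. *)
Lemma ty_probe m G : ty G env0 (iter m.+2 ident dstar) ->
  ty (probe m.+1 G) env0 (ident dstar).
Proof.
elim: m G => [|m IH] G h.
  by rewrite -[env0]eadd0; apply: ty_app1 h (ty_Iterm _).
rewrite /probe iterSr; apply: IH.
by rewrite -[env0]eadd0; apply: ty_app1 h (ty_Iterm _).
Qed.

(** Enough probes leave 0 or the identity, and the type that survives them excludes 0. All [delta]
    are assumed because the number of probes is known only after [G]. *)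
Lemma probe_solves G : (forall delta, ty G env0 (ident delta)) ->
  exists m, sum_reds [:: probe m G] [:: Iterm].
Proof.
move=> H; have [x|n tG] := @eventually_tame G.
  exact: ty_closed (H dstar).
exists n.+1; have [T GT IT] := tG n.+1 (leqnSn n).
have /(sty_reds _ _ GT)[I' TI' _] : sty [:: probe n.+1 G] env0 (ident dstar).
  by apply/sty1/ty_probe/H.
apply: sum_reds_trans GT _; apply/sum_reds_refl/sum_eq_mem => K.
rewrite inE; apply/idP/eqP => [/IT//|->].
by rewrite -(IT _ TI').
Qed.

(** * Contexts *)

Lemma ty_abs x M e alpha : ty (abs x M) e alpha <->
  exists e' beta, [/\ e = (fun n => if n == x then mset0 else e' n),
    alpha = dcons (e' x) beta & ty M e' beta].
Proof.
(* The renaming in [abs] is injective and misses [x.+1], so the environment is empty at [x] after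
   binding. *)
have fg : cancel (fun y => if y == x then 0 else y.+1)
    (fun n => if n is m.+1 then m else x).
  by move=> y; case: eqP => [->|].
have Ep e' : epush (fun y => if y == x then 0 else y.+1)
    (fun n => if n is m.+1 then m else x) e' =
    econs (e' x) (fun n => if n == x then mset0 else e' n).
  apply: functional_extensionality => -[|n]; rewrite /epush /= ?eqxx //.
  by case: (n == x); rewrite //= eqxx.
split=> [[b [beta [-> /(ty_ren _ _ _ fg)[e' /[!Ep]/econs_inj[-> ->] h]]]]|].
  by exists e', beta.
move=> [e' [beta [-> -> h]]]; apply: ty_lam; apply/(ty_ren _ _ _ fg).
by exists e'; rewrite ?Ep.
Qed.

(** A typing derivation types every subterm, bag elements included, and so the content of the
    hole. *)
Lemma ty_plug D M e alpha : ty (plug D M) e alpha ->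
  exists e' beta, ty M e' beta.
Proof.
elim: D e alpha => /= [|x D IH|D IH P|N D IH P] e alpha.
- by exists e, alpha.
- by move=> /ty_abs[e' [beta [_ _ /IH]]].
- by move=> [e1 [e2 [b [_ /IH]]]].
by move=> [e1 [e2 [b [_ _ [f1 [f2 [beta [b' [_ _ /IH]]]]]]]]].
Qed.

(** Substitution of the bags [s x] for the variables, expressed by nested redexes whose binders
    capture. *)
Definition close (s : nat -> bag) (xs : seq nat) : ctx :=
  foldr (fun x D => CAppl (CLam x D) (s x)) CHole xs.

Lemma ty_close s xs M e alpha : uniq xs -> ty M e alpha -> inhabits s e ->
  ty (plug (close s xs) M) (fun n => if n \in xs then mset0 else e n) alpha.
Proof.
move=> + h i; elim: xs => [//|x xs IH /andP[xxs /IH {}IH]].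
rewrite -[X in ty _ X _]eadd0; apply: ty_app (i x); apply/ty_abs.
exists (fun n => if n \in xs then mset0 else e n), alpha; split=> //.
  apply: functional_extensionality => n; rewrite inE.
  by case: eqP.
(* Without repetitions, [x] still has its original multiset [e x], which [s x] inhabits. *)
by rewrite (negPf xxs).
Qed.

Lemma plug_appl Qs D M : plug (foldl CAppl D Qs) M = foldl App (plug D M) Qs.
Proof. by elim: Qs D => //= Q Qs IH D; rewrite IH. Qed.

Lemma plug_probe m D M :
  plug (iter m (fun D => CAppl D [:: Iterm]) D) M = probe m (plug D M).
Proof. by elim: m => //= m ->. Qed.

(** * The implications between the three conditions *)

Lemma solvable_ty M : solvable M -> exists e alpha, ty M e alpha.
Proof.
move=> [D DM]; apply: (ty_plug (D := D) (e := env0) (alpha := ident dstar)).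
by apply/sty1/(sty_reds _ _ DM)/sty1/ty_Iterm.
Qed.

Lemma ty_has_normal_summand M e alpha : ty M e alpha -> has_normal_summand M.
Proof.
move=> h; have [T MT nT] := normalizing M.
have /(sty_reds _ _ MT)[N NT _] : sty [:: M] e alpha by apply/sty1.
exists N, T; split; first exact: nT.
apply: sum_reds_trans MT _; apply/sum_reds_refl/sum_eq_mem => K.
by rewrite inE; case: eqP => // ->.
Qed.

Lemma has_normal_summand_solvable M xs : uniq xs ->
  (forall x, free x M -> x \in xs) -> has_normal_summand M -> solvable M.
Proof.
move=> uxs Mxs [N [S [/normal_closable[s [Qs H]] MN]]].
pose D := foldl CAppl (close s xs) Qs.
have [delta|m pm] := @probe_solves (plug D M).
  have [e [alpha [hN i hQ]]] := H delta.
  (* The context is built from [N] but applied to [M], which has every typing of [N] by subject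
     expansion. *)
  have hM : ty M e alpha.
    by apply/sty1/(sty_reds _ _ MN); exists N; rewrite ?mem_head.
  rewrite plug_appl; apply: ty_args hQ.
  (* Outside [xs] nothing is free in [M], so [e] is empty there by [ty_free]. *)
  have -> : env0 = fun n => if n \in xs then mset0 else e n.
    apply: functional_extensionality => n; case: (boolP (n \in xs)) => // nxs.
    apply/esym/eqP; rewrite -[_ == _]negbK -(ty_free n hM).
    by apply: contra nxs => /Mxs.
  exact: ty_close.
by exists (iter m (fun D => CAppl D [:: Iterm]) D); rewrite plug_probe.
Qed.

Theorem theorem6p5 (M : term) (xs : seq nat)
    (uniq_xs : uniq xs) (free_xs : forall x : nat, free x M -> x \in xs) :
  (solvable M <-> has_normal_summand M) /\
  (has_normal_summand M <-> exists a alpha, interp xs M a alpha).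
Proof.
have NS := has_normal_summand_solvable uniq_xs free_xs.
split; split=> //.
- by move=> /solvable_ty[e [alpha /ty_has_normal_summand]].
- move=> /NS/solvable_ty[e [alpha h]]; exists (map e xs), alpha.
  exact: ty_interp.
by move=> [a [alpha /interp_ty[e _ /ty_has_normal_summand]]].
Qed.
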